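(* Let $A$ be a Banach algebra such that $A^{**}$ has a mixed unit $e''$. Then: (i) Let $B$ be a left Banach $A$-module with action $\pi_\ell:A\times B\to B$. Then $B^*$ factors on the left with respect to $A$ (i.e. $B^*=B^*A$) if and only if $e''$ is a left unit $A^{**}$-module for $B^{**}$, i.e. $\pi_\ell^{***}(e'',b'')=b''$ for all $b''\in B^{**}$. (ii) Let $B$ be a right Banach $A$-module with action $\pi_r:B\times A\to B$, and suppose $Z_{e''}(\pi_r^t)=B^{**}$. Then $B^*$ factors on the right with respect to $A$ (i.e. $B^*=AB^*$) if and only if $e''$ is a right unit $A^{**}$-module for $B^{**}$, i.e. $\pi_r^{***}(b'',e'')=b''$ for all $b''\in B^{**}$. (iii) Let $B$ be a Banach $A$-bimodule with left and right actions $\pi_\ell$ and $\pi_r$, and suppose $Z_{e''}(\pi_r^t)=B^{**}$. Then $B^*$ factors on both sides with respect to $A$ (i.e. $B^*=B^*A=AB^*$) if and only if $e''$ is a unit $A^{**}$-module for $B^{**}$, i.e. $\pi_\ell^{***}(e'',b'')=b''=\pi_r^{***}(b'',e'')$ for all $b''\in B^{**}$.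
   Context: For normed spaces $X,Y,Z$ and a bounded bilinear map $m:X\times Y\to Z$, define $m^*:Z^*\times X\to Y^*$ by $\langle m^*(z',x),y\rangle=\langle z',m(x,y)\rangle$; $m^{**}:Y^{**}\times Z^*\to X^*$ by $\langle m^{**}(y'',z'),x\rangle=\langle y'',m^*(z',x)\rangle$; $m^{***}:X^{**}\times Y^{**}\to Z^{**}$ by $\langle m^{***}(x'',y''),z'\rangle=\langle x'',m^{**}(y'',z')\rangle$. Let $m^t(y,x)=m(x,y)$ be the transpose of $m$; applying the construction to $m^t$ gives $m^{t***}:Y^{**}\times X^{**}\to Z^{**}$, whose transpose is $m^{t***t}:X^{**}\times Y^{**}\to Z^{**}$. If $\pi:A\times A\to A$ is the multiplication of $A$, the first and second Arens products on $A^{**}$ are $a''b''=\pi^{***}(a'',b'')$ and $a''\,o\,b''=\pi^{t***t}(a'',b'')$. An element $e''\in A^{**}$ is a mixed unit if $a''e''=e''\,o\,a''=a''$ for all $a''\in A^{**}$ (equivalently, $e''$ is a weak$^*$ cluster point of some bounded approximate identity of $A$). If $B$ is a left Banach $A$-module, $B^*$ is a right Banach $A$-module via $\langle b'a,b\rangle=\langle b',ab\rangle$; if $B$ is a right Banach $A$-module, $B^*$ is a left Banach $A$-module via $\langle ab',b\rangle=\langle b',ba\rangle$. $B^*A=\{b'a:b'\in B^*,a\in A\}$ and $AB^*=\{ab':a\in A,b'\in B^*\}$ denote sets of products. For $a''\in A^{**}$ the locally topological center is $$Z_{a''}(\pi_r^t)=\{b''\in B^{**}:\ \pi_r^{t***t}(b'',a'')=\pi_r^{***}(b'',a'')\}.$$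 *)

(* Defs.v *)
From HB Require Import structures.
From mathcomp Require Import all_boot all_order all_algebra.
From mathcomp Require Import sesquilinear complex.
From mathcomp Require Import all_classical all_reals all_analysis.

Set Implicit Arguments.
Unset Strict Implicit.
Unset Printing Implicit Defensive.

Import Order.TTheory GRing.Theory Num.Theory.
Import numFieldNormedType.Exports.

Local Open Scope classical_set_scope.
Local Open Scope ring_scope.

Variant scalar_kind := RealScalars | ComplexScalars.

Definition scalars (R : realType) (k : scalar_kind) : numFieldType :=
  match k with RealScalars => R | ComplexScalars => R[i] end.

Lemma scalars_supremums (R : realType) (k : scalar_kind)
    (E : set (scalars R k)) (M : scalars R k) :
  E !=set0 -> (forall x, E x -> 0 <= x) -> ubound E M -> supremums E !=set0.
Proof.
case: k E M => /= E M [x0 Ex0] E0 EM.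
  have hsE : has_sup E by split; [exists x0 | exists M].
  exists (sup E); split => [x Ex|y yE]; first exact: sup_upper_bound.
  by apply: ge_sup => //; exists x0.
have ReE x : E x -> x = (complex.Re x)%:C%C.
  by move=> /E0 /ger0_real /RRe_real.
pose F := [set complex.Re x | x in E].
have hsF : has_sup F.
  split; first by exists (complex.Re x0), x0.
  exists (complex.Re M) => _ [x Ex <-].
  by have := EM x Ex; rewrite lecE => /andP[].
exists (sup F)%:C%C; split => [x Ex|y yE].
  by rewrite (ReE _ Ex) lecR; apply: sup_upper_bound => //; exists x.
have := yE _ Ex0; rewrite (ReE _ Ex0) !lecE /= => /andP[-> _] /=.
apply: ge_sup; first by exists (complex.Re x0), x0.
by move=> _ [x Ex <-]; have := yE x Ex; rewrite lecE => /andP[].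
Qed.

Lemma ler_mul_norm (K : numFieldType) (M c d : K) :
  0 <= c -> 0 <= d -> d <= M * c -> d <= `|M| * c.
Proof.
move=> c0 d0 dMc; apply: (le_trans dMc).
have [->|cn0] := eqVneq c 0; first by rewrite !mulr0.
have cgt0 : 0 < c by rewrite lt_def cn0.
rewrite ler_pM2r//; apply: real_ler_norm.
by have := le_trans d0 dMc; rewrite pmulr_lge0// => /ger0_real.
Qed.

Section dual.
Context {R : realType} {k : scalar_kind}.
Local Notation K := (scalars R k).
Variable X : normedModType K.

Definition dual_pred : {pred X -> K^o} :=
  [pred f | `[< linear f /\ continuous f >]].

Lemma dual_submod_closed : submod_closed dual_pred.
Proof.
split; first by apply/asboolP; split => [a x y|x];
  [rewrite /= scaler0 addr0 | exact: cvg_cst].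
move=> a f g /asboolP[fl fc] /asboolP[gl gc]; apply/asboolP; split.
  move=> b x y; rewrite !fctE fl gl !scalerDr !scalerA.
  by rewrite [a * b]mulrC -!addrA; congr (_ + _); rewrite addrCA.
move=> x; apply: cvgD; last exact: gc.
by apply: cvgZl_tmp; exact: fc.
Qed.

HB.instance Definition _ := GRing.isSubmodClosed.Build K (X -> K^o) dual_pred
  dual_submod_closed.

Record dual : Type := Dual {
  dual_fun :> X -> K^o;
  dual_funP : dual_fun \in dual_pred
}.

HB.instance Definition _ := [isSub for dual_fun].
HB.instance Definition _ := [Choice of dual by <:].
HB.instance Definition _ := [SubChoice_isSubLmodule of dual by <:].

Lemma dual_linear (f : dual) : linear f.
Proof. by have /asboolP[] := dual_funP f. Qed.

HB.instance Definition _ (f : dual) :=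
  GRing.isLinear.Build K X K^o *:%R (dual_fun f) (dual_linear f).

Lemma dual_continuous (f : dual) : continuous f.
Proof. by have /asboolP[] := dual_funP f. Qed.

Lemma dualP (f g : dual) : (forall x, f x = g x) -> f = g.
Proof. by move=> fg; apply/val_inj/funext. Qed.

Lemma dual_addE (f g : dual) x : (f + g) x = f x + g x.
Proof. by []. Qed.

Lemma dual_scaleE (a : K) (f : dual) x : (a *: f) x = a * f x.
Proof. by []. Qed.

(* Norms are [K]-valued, hence the supremum in the (for complex scalars
   partially) ordered field [K]; it exists by [scalars_supremums]. *)
Definition opnorm (f : dual) : K :=
  supremum 0 [set `|f x| | x in [set x | `|x| <= 1]].

Lemma opnorm_supremums (f : dual) :
  supremums [set `|f x| | x in [set x | `|x| <= 1]] (opnorm f).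
Proof.
have E0 : [set `|f x| | x in [set x | `|x| <= 1]] !=set0.
  by exists `|f 0|, 0; rewrite //= normr0.
have [M Mf] : exists M, forall x, `|f x| <= M * `|x|.
  have /linear_boundedP/pinfty_ex_gt0[M _ Mf] :=
    (linear_bounded_continuous f).2 (@dual_continuous f).
  by exists M.
rewrite /opnorm /supremum ifF; last exact/negbTE/set0P.
have [s Es] : supremums [set `|f x| | x in [set x | `|x| <= 1]] !=set0.
  apply: (@scalars_supremums _ _ _ `|M|) => // [_ [x _ <-]//|_ [x /= x1 <-]].
  by apply: (le_trans (ler_mul_norm _ _ (Mf x))); rewrite ?ler_piMr.
by case: xgetP => [_ -> //|/(_ s)].
Qed.

Lemma opnorm_ge0 (f : dual) : 0 <= opnorm f.
Proof.
have [ub _] := opnorm_supremums f.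
apply: le_trans (ub `|f 0| _); rewrite ?normr_ge0//.
by exists 0; rewrite //= normr0.
Qed.

Lemma le_opnorm (f : dual) x : `|f x| <= opnorm f * `|x|.
Proof.
have [->|x0] := eqVneq x 0; first by rewrite linear0 !normr0 mulr0.
have [ub _] := opnorm_supremums f.
rewrite -ler_pdivrMr ?normr_gt0//.
apply: le_trans (ub `|f (`|x|^-1 *: x)| _); last first.
  by exists (`|x|^-1 *: x) => //=; rewrite normfZV.
by rewrite linearZ/= normrZ normfV normr_id mulrC.
Qed.

Lemma opnorm_le (f : dual) M :
  0 <= M -> (forall x, `|f x| <= M * `|x|) -> opnorm f <= M.
Proof.
move=> M0 Mf; have [_ lub] := opnorm_supremums f.
by apply: lub => _ [x /= x1 <-]; apply: (le_trans (Mf x)); rewrite ler_piMr.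
Qed.

Lemma opnormD f g : opnorm (f + g) <= opnorm f + opnorm g.
Proof.
apply: opnorm_le => [|x]; first by rewrite addr_ge0 ?opnorm_ge0.
by rewrite dual_addE mulrDl (le_trans (ler_normD _ _))// lerD ?le_opnorm.
Qed.

Lemma opnormZ (a : K) f : opnorm (a *: f) = `|a| * opnorm f.
Proof.
have le b g : opnorm (b *: g) <= `|b| * opnorm g.
  apply: opnorm_le => [|x]; first by rewrite mulr_ge0 ?opnorm_ge0.
  by rewrite dual_scaleE normrM -mulrA ler_wpM2l ?le_opnorm.
apply/eqP; rewrite eq_le le/=; have [->|a0] := eqVneq a 0.
  by rewrite normr0 mul0r opnorm_ge0.
rewrite -ler_pdivlMl ?normr_gt0// -normfV.
by have := le a^-1 (a *: f); rewrite scalerA mulVf// scale1r.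
Qed.

Lemma opnorm0_eq0 f : opnorm f = 0 -> f = 0.
Proof.
move=> f0; apply: dualP => x; apply/eqP.
by rewrite -normr_le0 (le_trans (le_opnorm f x))// f0 mul0r.
Qed.

HB.instance Definition _ :=
  Lmodule_isNormed.Build K dual opnormD opnormZ opnorm0_eq0.

End dual.

Notation bidual X := (dual (dual X)).

Section bounded_bilinear.
Context {R : realType} {k : scalar_kind}.
Local Notation K := (scalars R k).

Record bounded_bilinear (X Y Z : normedModType K) := BoundedBilinear {
  bb_fun :> {bilinear X -> Y -> Z};
  bb_bounded : exists M : K, forall x y, `|bb_fun x y| <= M * `|x| * `|y|
}.


Section transpose.
Context {X Y Z : normedModType K}.
Variable m : bounded_bilinear X Y Z.

Definition transpose_fun (y : Y) (x : X) : Z := m x y.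

Lemma transpose_bilinear : bilinear_for *:%R *:%R transpose_fun.
Proof. by split=> [x|y] a u v; rewrite /transpose_fun ?linearPr ?linearPl. Qed.

HB.instance Definition _ :=
  bilinear_isBilinear.Build K Y X Z *:%R *:%R transpose_fun transpose_bilinear.

Lemma transpose_bounded :
  exists M : K, forall y x, `|transpose_fun y x| <= M * `|y| * `|x|.
Proof.
have [M mM] := bb_bounded m; exists M => y x.
by rewrite /transpose_fun mulrAC; exact: mM.
Qed.

Definition transpose : bounded_bilinear Y X Z :=
  BoundedBilinear transpose_bounded.

End transpose.

Lemma bb_bounded_ge0 (X Y Z : normedModType K) (m : bounded_bilinear X Y Z) :
  exists2 M : K, 0 <= M & forall x y, `|m x y| <= M * `|x| * `|y|.
Proof.
have [M mM] := bb_bounded m; exists `|M| => // x y.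
by rewrite -mulrA ler_mul_norm ?mulr_ge0// mulrA.
Qed.

Section adjoint.
Context {X Y Z : normedModType K}.
Variable m : bounded_bilinear X Y Z.

Lemma adjoint_subproof (z' : dual Z) (x : X) :
  (fun y => z' (m x y)) \in @dual_pred _ _ Y.
Proof.
apply/asboolP; have lin : linear (fun y => z' (m x y) : K^o).
  by move=> a u v; rewrite linearPr linearP.
split => // y; apply: (continuous_comp (g := z')); last exact: dual_continuous.
have [M M0 mM] := bb_bounded_ge0 m.
apply: bounded_linear_continuous; apply/linear_boundedP; near=> r => u.
apply: (le_trans (mM x u)); rewrite ler_wpM2r//.
by near: r; apply: nbhs_pinfty_ge; rewrite ger0_real// mulr_ge0.
Unshelve. all: by end_near. Qed.

Definition adjoint_fun (z' : dual Z) (x : X) : dual Y :=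
  Dual (adjoint_subproof z' x).

Lemma adjoint_bilinear : bilinear_for *:%R *:%R adjoint_fun.
Proof.
split=> [x|z'] a u v; apply: dualP => y //.
by rewrite dual_addE dual_scaleE /= linearPl linearP.
Qed.

HB.instance Definition _ := bilinear_isBilinear.Build K (dual Z) X (dual Y)
  *:%R *:%R adjoint_fun adjoint_bilinear.

Lemma adjoint_bounded :
  exists M : K, forall z' x, `|adjoint_fun z' x| <= M * `|z'| * `|x|.
Proof.
have [M M0 mM] := bb_bounded_ge0 m; exists M => z' x.
apply: opnorm_le => [|y]; first by rewrite !mulr_ge0.
apply: (le_trans (le_opnorm z' _)); rewrite [M * _]mulrC -!mulrA.
by rewrite ler_wpM2l ?opnorm_ge0// mulrA.
Qed.

Definition adjoint : bounded_bilinear (dual Z) X (dual Y) :=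
  BoundedBilinear adjoint_bounded.

Lemma adjointE (z' : dual Z) x y : adjoint z' x y = z' (m x y).
Proof. by []. Qed.

End adjoint.

Definition triadjoint {X Y Z : normedModType K} (m : bounded_bilinear X Y Z) :
    bounded_bilinear (bidual X) (bidual Y) (bidual Z) :=
  adjoint (adjoint (adjoint m)).

(* MathComp rings have a unit, which a Banach algebra need not have, so the
   multiplication is given as a bounded bilinear map on a Banach space. *)
Definition banach_algebra (A : completeNormedModType K)
    (pi : bounded_bilinear A A A) : Prop :=
  (forall a b c, pi a (pi b c) = pi (pi a b) c) /\
  (forall a b, `|pi a b| <= `|a| * `|b|).

Definition arens1 (A : normedModType K) (pi : bounded_bilinear A A A)
    (a'' b'' : bidual A) : bidual A :=
  triadjoint pi a'' b''.

Definition arens2 (A : normedModType K) (pi : bounded_bilinear A A A)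
    (a'' b'' : bidual A) : bidual A :=
  transpose (triadjoint (transpose pi)) a'' b''.

Definition mixed_unit (A : normedModType K) (pi : bounded_bilinear A A A)
    (e'' : bidual A) : Prop :=
  forall a'', arens1 pi a'' e'' = a'' /\ arens2 pi e'' a'' = a''.

Section modules.
Context {A B : completeNormedModType K}.
Variable pi : bounded_bilinear A A A.

(* Boundedness of the actions is part of [bounded_bilinear]; the bound is not
   required to be 1, and the modules need not be essential. *)
Definition left_banach_module (pil : bounded_bilinear A B B) : Prop :=
  forall a a' b, pil (pi a a') b = pil a (pil a' b).

Definition right_banach_module (pir : bounded_bilinear B A B) : Prop :=
  forall b a a', pir b (pi a a') = pir (pir b a) a'.

Definition banach_bimodule (pil : bounded_bilinear A B B)
    (pir : bounded_bilinear B A B) : Prop :=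
  [/\ left_banach_module pil, right_banach_module pir &
      forall a b a', pir (pil a b) a' = pil a (pir b a')].

Definition dual_ract (pil : bounded_bilinear A B B) :
  bounded_bilinear (dual B) A (dual B) := adjoint pil.

Definition dual_lact (pir : bounded_bilinear B A B) :
  bounded_bilinear A (dual B) (dual B) := transpose (adjoint (transpose pir)).

Lemma dual_ractE pil (b' : dual B) a b : dual_ract pil b' a b = b' (pil a b).
Proof. by []. Qed.

Lemma dual_lactE pir a (b' : dual B) b : dual_lact pir a b' b = b' (pir b a).
Proof. by []. Qed.

(* Sets of products, not their linear spans. *)
Definition factors_left (pil : bounded_bilinear A B B) : Prop :=
  [set: dual B] = [set dual_ract pil b' a | b' in setT & a in setT].

Definition factors_right (pir : bounded_bilinear B A B) : Prop :=
  [set: dual B] = [set dual_lact pir a b' | a in setT & b' in setT].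

(* The center Z_{a''}(pir^t). *)
Definition locally_top_center (pir : bounded_bilinear B A B) (a'' : bidual A) :
    set (bidual B) :=
  [set b'' | transpose (triadjoint (transpose pir)) b'' a''
             = triadjoint pir b'' a''].

Definition left_unit_module (pil : bounded_bilinear A B B) (e'' : bidual A) :
    Prop :=
  forall b'', triadjoint pil e'' b'' = b''.

Definition right_unit_module (pir : bounded_bilinear B A B) (e'' : bidual A) :
    Prop :=
  forall b'', triadjoint pir b'' e'' = b''.

End modules.

End bounded_bilinear.

(* Main.v *)
From HB Require Import structures.
Require Import Defs.
From mathcomp Require Import all_boot all_order all_algebra.
From mathcomp Require Import complex.
From mathcomp Require Import all_classical all_reals all_analysis.
From mathcomp Require Import ring lra.

Set Implicit Arguments.
Unset Strict Implicit.
Unset Printing Implicit Defensive.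

Import Order.TTheory GRing.Theory Num.Theory.
Import numFieldNormedType.Exports.

Local Open Scope classical_set_scope.
Local Open Scope ring_scope.

(** Parts (i) and (ii) are one statement read in A and in its opposite algebra.
Transposing the multiplication and the action turns a right module into a
left one, and exchanges the two Arens products, so that the half of the
mixed unit condition used on either side becomes [a'' e'' = a''] for the
first product.  The hypothesis on the locally topological center of
[e''] is what identifies the transposed product
[triadjoint (transpose pir) e'' b''] with [triadjoint pir b'' e''].  Part (iii)
is the conjunction of the other two.

For a left module, take first [b' = c' a].  Evaluated at [b'], the element
[e'' b''] is [e'' (adjoint pi f a)], where the functional
[f = adjoint (adjoint pil) b'' c'] lies in the dual of A.  The unit condition,
tested on the image of [a] in the bidual, says that this number is [f a]
([right_unit_adjoint]), which is [b'' (c' a)].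

Conversely, suppose [e'' b'' = b''] for all [b''].  A Hahn-Banach argument
replaces [e''] by elements of A of norm at most [|e''| + 1] that almost fix,
on the right, both a given [a] in A and a given [b'] in the dual of B
([unit_approximation], from [bidual_approximation]).  Cohen's
method then factors [b'] ([cohen_factorization]).  In a dual module it
takes a simple form: by Hahn-Banach again, [b' = y a] has a solution [y] as
soon as [|b' v| <= C |a v|] for all [v] in B ([dual_factor]), and such an
inequality passes to the limit along a sequence.  The sequence is
[a_n = ((1-c) + c e_0) ... ((1-c) + c e_(n-1))], computed in A with a formal
unit adjoined: its scalar part [(1-c)^n] vanishes in the limit, so the limit lies
in A; each factor is bounded below on B, and [e_n] is chosen after [a_n], so
near to a unit that the constant C grows by a summable amount only.

The Hahn-Banach theorem comes from minimal sublinear functionals, which exist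
by Zorn's lemma and are linear; the complex case follows by taking
real parts. *)

(** * Real Hahn-Banach *)

Section sublinear.
Context {R : realType} {V : lmodType R}.
Implicit Types (p q : V -> R) (u v w : V).

Definition sublinear p :=
  (forall u v, p (u + v) <= p u + p v) /\
  (forall a v, 0 < a -> p (a *: v) = a * p v).

Lemma sublinear0 p : sublinear p -> p 0 = 0.
Proof.
case=> _ pZ; have := pZ 2 0 (ltr0Sn _ 1); rewrite scaler0 => p0.
by lra.
Qed.

Lemma sublinear_ge p v : sublinear p -> - p (- v) <= p v.
Proof.
move=> sp; have := sp.1 v (- v); rewrite subrr sublinear0//.
by rewrite -subr_ge0 => ?; lra.
Qed.

(** An infimum of sublinear functionals need not be subadditive; this is the
    directedness condition under which it is.  The sets [E v] cover both the
    values at [v] of a chain of functionals and the tilted values below. *)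
Lemma inf_sublinear (E : V -> set R) :
  (forall v, E v !=set0) -> (forall v, has_lbound (E v)) ->
  (forall u v s t, E u s -> E v t -> exists2 r, E (u + v) r & r <= s + t) ->
  (forall a v s, 0 < a -> E v s -> E (a *: v) (a * s)) ->
  sublinear (fun v => inf (E v)).
Proof.
move=> E0 lbE ED EZ; split=> [u v|a v a0].
  rewrite -lerBlDr; apply: lb_le_inf => // s us.
  rewrite lerBlDr -lerBlDl; apply: lb_le_inf => // t vt.
  have [r uvr rst] := ED _ _ _ _ us vt.
  by rewrite lerBlDl (le_trans _ rst)// ge_inf.
have leZ b w : 0 < b -> inf (E (b *: w)) <= b * inf (E w).
  move=> b0; rewrite -ler_pdivrMl//; apply: lb_le_inf => // s ws.
  by rewrite ler_pdivrMl// ge_inf//; exact: EZ.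
apply/eqP; rewrite eq_le leZ//= -ler_pdivlMl//.
by rewrite -{1}[v](scalerK (lt0r_neq0 a0)) leZ ?invr_gt0.
Qed.

(** A linear functional below [q] satisfies every constraint of the cone [D]: its
    value at [w] is at least [t] when [D w t], because [q (- w) <= - t].  The
    witness is [q v = inf (p (v + w) - t)] over [D w t]. *)
Lemma tilt_sublinear p (D : V -> R -> Prop) : sublinear p ->
  D 0 0 ->
  (forall w w' t t', D w t -> D w' t' -> D (w + w') (t + t')) ->
  (forall a w t, 0 < a -> D w t -> D (a *: w) (a * t)) ->
  (forall w t, D w t -> t <= p w) ->
  exists q, [/\ sublinear q, forall v, q v <= p v &
                forall w t, D w t -> q (- w) <= - t].
Proof.
move=> sp D0 DD DZ Dp.
pose E v : set R := [set r | exists w t, D w t /\ r = p (v + w) - t].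
have lbE v : has_lbound (E v).
  exists (- p (- v)) => _ [w [t [Dwt ->]]].
  have := sp.1 (v + w) (- v); rewrite addrAC subrr add0r.
  by have := Dp _ _ Dwt; lra.
have Ep v w t : D w t -> inf (E v) <= p (v + w) - t.
  by move=> Dwt; apply: ge_inf => //; exists w, t.
exists (fun v => inf (E v)); split.
- apply: inf_sublinear => //.
  + by move=> v; exists (p (v + 0) - 0), 0, 0.
  + move=> u v _ _ [w [t [Dw ->]]] [w' [t' [Dw' ->]]].
    exists (p ((u + v) + (w + w')) - (t + t')).
      by exists (w + w'), (t + t'); split=> //; exact: DD.
    by have := sp.1 (u + w) (v + w'); rewrite addrACA; lra.
  + move=> a v _ a0 [w [t [Dw ->]]].
    exists (a *: w), (a * t); split; first exact: DZ.
    by rewrite -scalerDr sp.2// mulrBr.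
- by move=> v; apply: (le_trans (Ep v _ _ D0)); rewrite addr0 subr0.
- move=> w t Dw; apply: (le_trans (Ep _ _ _ Dw)).
  by rewrite addNr sublinear0// sub0r.
Qed.

Lemma minimal_sublinear_below p : sublinear p ->
  exists q, [/\ sublinear q, forall v, q v <= p v &
    forall q', sublinear q' -> (forall v, q' v <= q v) ->
      forall v, q v <= q' v].
Proof.
move=> sp.
pose T := {q : V -> R | sublinear q /\ forall v, q v <= p v}.
pose ge (f g : T) := `[< forall v, sval g v <= sval f v >].
pose p0 : T := exist _ p (conj sp (fun=> lexx _)).
have [||A Atot|q maxq] := @ZL_preorder T p0 ge.
- by move=> f; apply/asboolP.
- move=> f g h /asboolP gf /asboolP hg; apply/asboolP => v.
  exact: le_trans (hg v) (gf v).
- have [->|/set0P[f0 Af0]] := eqVneq A set0; first by exists p0.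
  pose E v : set R := [set sval f v | f in A].
  have lbE v : has_lbound (E v).
    exists (- p (- v)) => _ [[f [sf fp]] _ <-] /=.
    by have := sublinear_ge v sf; have := fp (- v); lra.
  have sE : sublinear (fun v => inf (E v)).
    apply: inf_sublinear => //.
    + by move=> v; exists (sval f0 v), f0.
    + move=> u v _ _ [f Af <-] [g Ag <-].
      have [/asboolP gf|/asboolP fg] := Atot _ _ Af Ag.
        exists (sval g (u + v)); first by exists g.
        have [[sg _] _] := svalP g.
        by apply: (le_trans (sg u v)); rewrite lerD2r.
      exists (sval f (u + v)); first by exists f.
      have [[sf _] _] := svalP f.
      by apply: (le_trans (sf u v)); rewrite lerD2l.
    + move=> a v _ a0 [f Af <-]; exists f => //.
      by have [[_ fZ] _] := svalP f; exact: fZ.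
  have leE v f : A f -> inf (E v) <= sval f v.
    by move=> Af; apply: ge_inf => //; exists f.
  have Ep v : inf (E v) <= p v.
    by apply: (le_trans (leE v f0 Af0)); have [_] := svalP f0; apply.
  exists (exist _ (fun v => inf (E v)) (conj sE Ep)) => f Af.
  apply/asboolP => v /=; exact: leE.
- have [sq qp] := svalP q; exists (sval q); split=> // q' sq' q'q v.
  have q'p u : q' u <= p u by exact: le_trans (q'q u) (qp u).
  suff /asboolP : ge (exist _ q' (conj sq' q'p)) q by apply.
  by apply: maxq; apply/asboolP.
Qed.

(** Tilting [q] along the ray through [v] changes nothing when [q] is minimal,
    so [q (- v) <= - q v]; this makes [q] superadditive. *)
Lemma minimal_sublinear_linear q : sublinear q ->
  (forall q', sublinear q' -> (forall v, q' v <= q v) ->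
    forall v, q v <= q' v) ->
  linear (q : V -> R^o).
Proof.
move=> sq minq.
have qD u v : q (u + v) = q u + q v.
  apply/eqP; rewrite eq_le sq.1/=.
  pose D w t := exists2 a, 0 <= a & w = a *: v /\ t = a * q v.
  have [||||q' [sq' q'q q'D]] := @tilt_sublinear q D sq.
  - by exists 0 => //; rewrite scale0r mul0r.
  - move=> _ _ _ _ [a a0 [-> ->]] [b b0 [-> ->]]; exists (a + b).
      exact: addr_ge0.
    by rewrite scalerDl mulrDl.
  - move=> a _ _ a0 [b b0 [-> ->]]; exists (a * b).
      by rewrite mulr_ge0// ltW.
    by rewrite scalerA mulrA.
  - move=> _ _ [a + [-> ->]]; rewrite le0r => /orP[/eqP ->|a0].
      by rewrite scale0r mul0r sublinear0.
    by rewrite sq.2.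
  have qq' w : q' w = q w by apply/eqP; rewrite eq_le q'q minq.
  have qN : q (- v) <= - q v.
    by rewrite -qq'; apply: q'D; exists 1; rewrite ?scale1r ?mul1r.
  by have := sq.1 (u + v) (- v); rewrite addrK; lra.
have qN v : q (- v) = - q v.
  by apply/eqP; rewrite -addr_eq0 -qD addNr sublinear0.
move=> a u v; rewrite qD; congr (_ + _).
have [a0|a0|<-] := ltgtP 0 a; last by rewrite !scale0r sublinear0.
  exact: sq.2.
rewrite -[a *: u]opprK -scaleNr qN sq.2 ?oppr_gt0//.
by rewrite mulNr opprK.
Qed.

(** The subspace of the usual formulation is the range of [T]; the bound
    makes [g] factor through it.  Tilting [p] along the graph of
    [T u |-> g u] before taking a minimal functional forces [h (T u) >= g u],
    and the same at [- u] gives equality. *)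
Lemma real_hahn_banach (U : lmodType R) (T : {linear U -> V})
    (g : {linear U -> R^o}) p : sublinear p ->
  (forall u : U, g u <= p (T u)) ->
  exists h : V -> R^o,
    [/\ linear h, forall v, h v <= p v & forall u : U, h (T u) = g u].
Proof.
move=> sp gp.
pose D w t := exists u : U, w = T u /\ t = g u.
have [||||q [sq qp qD]] := @tilt_sublinear p D sp.
- by exists 0; rewrite !linear0.
- by move=> _ _ _ _ [u [-> ->]] [v [-> ->]]; exists (u + v); rewrite !linearD.
- by move=> a _ _ a0 [u [-> ->]]; exists (a *: u); rewrite !linearZ.
- by move=> _ _ [u [-> ->]].
have [h [sh hq minh]] := minimal_sublinear_below sq.
have lh := minimal_sublinear_linear sh minh.
have hN v : h (- v) = - h v.
  by have := lh (-1) v 0; rewrite !addr0 !scaleN1r sublinear0// addr0.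
exists h; split=> // [v|u]; first exact: le_trans (hq v) (qp v).
have leN (u' : U) : - h (T u') <= - g u'.
  by rewrite -hN; apply: le_trans (hq _) _; apply: qD; exists u'.
apply/eqP; rewrite eq_le; have := leN u; have := leN (- u).
by rewrite !linearN hN/= !opprK lerN2 => -> ->.
Qed.

End sublinear.

(** * Hahn-Banach over the complex numbers *)

Section realified.
Context {R : realType}.
Variable V : lmodType R[i].

(** A distinct name for [V], so that instance search finds real scalars. *)
Definition realified : Type := V.

HB.instance Definition _ := GRing.Zmodule.on realified.

Definition realified_scale (a : R) (v : realified) : realified :=
  (a%:C%C *: (v : V) : V).

Fact realified_scaleA a b v :
  realified_scale a (realified_scale b v) = realified_scale (a * b) v.
Proof. by rewrite /realified_scale scalerA rmorphM. Qed.

Fact realified_scale1 : left_id 1 realified_scale.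
Proof. by move=> v; rewrite /realified_scale rmorph1 scale1r. Qed.

Fact realified_scaleDr : right_distributive realified_scale +%R.
Proof. by move=> a u v; rewrite /realified_scale scalerDr. Qed.

Fact realified_scaleDl v :
  {morph realified_scale^~ v : a b / a + b >-> a + b}.
Proof. by move=> a b; rewrite /realified_scale rmorphD scalerDl. Qed.

HB.instance Definition _ := GRing.Zmodule_isLmodule.Build R realified
  realified_scaleA realified_scale1 realified_scaleDr realified_scaleDl.

Lemma realified_scaleE (a : R) (v : V) :
  a *: (v : realified) = a%:C%C *: v :> V.
Proof. by []. Qed.

End realified.

Section seminorm.
Context {K : numFieldType} {V : lmodType K}.

Definition seminorm (p : V -> K) :=
  (forall u v, p (u + v) <= p u + p v) /\
  (forall a v, p (a *: v) = `|a| * p v).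

Lemma seminorm_ge0 p v : seminorm p -> 0 <= p v.
Proof.
case=> pD pZ; have := pD v (- v); rewrite subrr -(scale0r 0) pZ normr0 mul0r.
by rewrite -scaleN1r pZ normrN1 mul1r -mulr2n pmulrn_lge0.
Qed.

End seminorm.

Section hahn_banach.
Context {R : realType}.

(** A complex functional is determined by its real part [h], as
    [H v = h v - i h (i v)].  Extend the real part of [g], and bound [|H v|] by
    rotating [v] until [H v] is real and nonnegative. *)
Lemma complex_hahn_banach (U V : lmodType R[i]) (T : {linear U -> V})
    (g : {linear U -> R[i]^o}) (p : V -> R[i]) :
  seminorm p -> (forall u, `|g u| <= p (T u)) ->
  exists h : V -> R[i]^o,
    [/\ linear h, forall v, `|h v| <= p v & forall u, h (T u) = g u].
Proof.
move=> sp gp.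
have ReP v : (complex.Re (p v))%:C%C = p v.
  by apply: RRe_real; apply: ger0_real; exact: seminorm_ge0.
pose P (v : realified V) : R := complex.Re (p v).
have sP : sublinear P.
  split=> [u v|a v a0]; rewrite /P.
    by rewrite -lecR rmorphD/= !ReP; exact: sp.1.
  apply: (@complexI R); rewrite rmorphM/= !ReP realified_scaleE sp.2.
  by rewrite ger0_norm// lecR ltW.
have Tlin : linear (T : realified U -> realified V).
  by move=> a u v; rewrite !realified_scaleE linearP.
have glin : linear ((fun u => complex.Re (g u)) : realified U -> R^o).
  move=> a u v; rewrite realified_scaleE linearP/= raddfD/=.
  by case: (g u) => x y /=; rewrite mul0r subr0.
pose T' : {linear realified U -> realified V} :=
  HB.pack (T : realified U -> realified V)
    (GRing.isLinear.Build _ _ _ _ _ Tlin).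
pose g' : {linear realified U -> R^o} :=
  HB.pack ((fun u => complex.Re (g u)) : realified U -> R^o)
    (GRing.isLinear.Build _ _ _ _ _ glin).
have [|h [hlin hP hT]] := @real_hahn_banach R _ _ T' g' P sP.
  move=> u; rewrite /P /g'/= -lecR ReP; apply: le_trans (gp u).
  by apply: le_trans (normc_ge_Re _); rewrite lecR ler_norm.
pose H (v : V) : R[i]^o := (h v +i* - h ('i%C *: v))%C.
have hD (u v : V) : h (u + v) = h u + h v.
  by have := hlin 1 u v; rewrite !scale1r.
have hZ (a : R) (v : V) : h (a%:C%C *: v) = a * h v.
  have h0 : h 0 = 0 by have := hD 0 0; rewrite addr0 => ?; lra.
  by have := hlin a v 0; rewrite realified_scaleE !addr0 h0 addr0.
have hN (v : V) : h (- v) = - h v.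
  by rewrite -scaleN1r -(rmorph1 (real_complex R)) -rmorphN hZ mulN1r.
have hC (x y : R) (u : V) : h ((x +i* y)%C *: u) = x * h u + y * h ('i%C *: u).
  by rewrite [(x +i* y)%C]complexE mulrC scalerDl -scalerA hD !hZ.
have hii (u : V) : h ('i%C *: ('i%C *: u)) = - h u.
  by rewrite scalerA -expr2 sqr_i scaleN1r hN.
have Hlin : linear H.
  move=> a u v; rewrite /H/=.
  have -> : 'i%C *: (a *: u + v) = a *: ('i%C *: u) + 'i%C *: v.
    by rewrite scalerDr !scalerA [a * _]mulrC.
  rewrite !hD; case: a => x y; rewrite !(hC x y) hii.
  apply/eqP; rewrite eq_complex/=; apply/andP; split; apply/eqP.
    by rewrite mulrN opprK.
  ring.
have H0 : H 0 = 0.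
  by have := Hlin (-1) 0 0; rewrite scaler0 addr0 scaleN1r addNr.
have HT u : H (T u) = g u.
  rewrite /H -linearZ/= (hT u) (hT ('i%C *: u)) /g'/= linearZ/=.
  by case: (g u) => x y /=; rewrite mul0r mul1r sub0r opprK.
exists H; split=> // v.
have [->|Hv0] := eqVneq (H v) 0.
  by rewrite normr0; exact: seminorm_ge0.
pose z := `|H v| / H v.
have z1 : `|z| = 1 by rewrite normrM normfV normr_id divff// normr_eq0.
have Hzv : H (z *: v) = `|H v|.
  have := Hlin z v 0; rewrite addr0 => ->.
  by rewrite H0 addr0 /z; exact: divfK.
rewrite -[leLHS](@RRe_real R); last exact: normr_real.
rewrite -Hzv -ReP lecR/=.
have -> : complex.Re (p v) = P (z *: v) by rewrite /P sp.2 z1 mul1r.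
exact: hP.
Qed.

End hahn_banach.

(** * Functionals over real or complex scalars *)

Section functionals.
Context {R : realType} {k : scalar_kind}.
Local Notation K := (scalars R k).

Lemma hahn_banach (U V : lmodType K) (T : {linear U -> V})
    (g : {linear U -> K^o}) (p : V -> K) :
  seminorm p -> (forall u, `|g u| <= p (T u)) ->
  exists h : V -> K^o,
    [/\ linear h, forall v, `|h v| <= p v & forall u, h (T u) = g u].
Proof.
case: k U V T g p => U V T g p sp gp; last exact: complex_hahn_banach.
have gp' u : g u <= p (T u) by exact: le_trans (ler_norm _) (gp u).
have [|h [hlin hp hT]] := @real_hahn_banach R V U T g p _ gp'.
  by split=> [|a v a0]; [exact: sp.1 | rewrite sp.2 ger0_norm// ltW].
exists h; split=> // v; rewrite real_ler_norml ?num_real// hp andbT.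
have := hp (- v); rewrite -scaleN1r sp.2 normrN1 mul1r.
have h0 : h 0 = 0.
  by have := hlin (-1) 0 0; rewrite scaler0 addr0 scaleN1r addNr.
by have := hlin (-1) v 0; rewrite !addr0 h0 addr0 !scaleN1r => ->; rewrite lerNl.
Qed.

Lemma bounded_linear_dual (X : normedModType K) (f : X -> K^o) (M : K) :
  linear f -> (forall x, `|f x| <= M * `|x|) ->
  exists F : dual X, forall x, F x = f x.
Proof.
move=> flin fM.
have fd : f \in @dual_pred _ _ X.
  apply/asboolP; split=> //.
  pose f' : {linear X -> K^o} :=
    HB.pack f (GRing.isLinear.Build _ _ _ _ _ flin).
  apply: (@bounded_linear_continuous _ _ _ f'); apply/linear_boundedP.
  near=> r => x; apply: (le_trans (ler_mul_norm _ _ (fM x))) => //.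
  rewrite ler_wpM2r//; near: r; exact: nbhs_pinfty_ge.
by exists (Dual fd).
Unshelve. all: by end_near. Qed.

(** The functional [L b |-> x b] on the range of [L] is well defined and
    bounded by [C]; extend it. *)
Lemma dual_factor (B W : normedModType K) (L : {linear B -> W}) (x : dual B)
    (C : K) : 0 <= C -> (forall b, `|x b| <= C * `|L b|) ->
  exists y : dual W, forall b, y (L b) = x b.
Proof.
move=> C0 xC.
pose p (w : W) := C * `|w|.
have sp : seminorm p.
  split=> [u v|a v]; rewrite /p; first by rewrite -mulrDr ler_wpM2l// ler_normD.
  by rewrite normrZ mulrCA.
have [h [hlin hp hL]] := @hahn_banach _ _ L x p sp xC.
have [y yE] := bounded_linear_dual hlin hp.
by exists y => b; rewrite yE hL.
Qed.

(** The hypothesis says that [y0] is the value at [e''] of the second adjoint of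
    [S].  Goldstine's theorem and the agreement of weak and norm closures of
    convex sets would give [e]; here both are obtained from one extension.
    If no [e] satisfies [|y0 - S e| / eps + |e| / M <= 1], then
    [(t y0 - S e, e) |-> t] is dominated by [|y| / eps + |a| / M].  An extension
    splits into a functional [phi] on Y with [phi y0 = 1] and a functional [chi]
    on A which is [phi] composed with [S] and has norm at most [1 / M], whence
    [1 = e'' chi <= |e''| / M < 1].  Any [M > |e''|] would do. *)
Lemma bidual_approximation (A Y : normedModType K) (S : {linear A -> Y})
    (y0 : Y) (e'' : bidual A) :
  (forall (phi : dual Y) (chi : dual A), (forall a, chi a = phi (S a)) ->
     e'' chi = phi y0) ->
  forall eps : K, 0 < eps ->
  exists e : A, `|e| <= `|e''| + 1 /\ `|y0 - S e| <= eps.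
Proof.
move=> he eps eps0; set M := `|e''| + 1.
have M0 : 0 < M by rewrite ltr_pwDr.
pose p (v : Y * A) := `|v.1| / eps + `|v.2| / M.
have sp : seminorm p.
  split=> [u v|a v]; rewrite /p.
    by rewrite addrACA -!mulrDl lerD// ler_pM2r ?invr_gt0// ler_normD.
  by rewrite !normrZ mulrDr !mulrA.
have p_ge0 v : 0 <= p v by exact: seminorm_ge0.
have [[e pe]|noe] := pselect (exists e, p (y0 - S e, e) <= 1).
  exists e; split.
    rewrite -[leRHS]mul1r -ler_pdivrMr//; apply: le_trans pe.
    by rewrite /p/= lerDr divr_ge0// ltW.
  rewrite -[leRHS]mul1r -ler_pdivrMr//; apply: le_trans pe.
  by rewrite /p/= lerDl divr_ge0// ltW.
have p_ge1 e : 1 <= p (y0 - S e, e).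
  have [//|/ltW pe] := real_leP (real1 K) (ger0_real (p_ge0 (y0 - S e, e))).
  by case: noe; exists e.
pose T0 (u : K^o * A) : Y * A := (u.1 *: y0 - S u.2, u.2).
have T0lin : linear T0.
  move=> a [s e] [s' e']; rewrite /T0/=; congr pair.
  by rewrite/= linearP scalerDl scalerBr -scalerA opprD addrACA.
pose T : {linear (K^o * A)%type -> (Y * A)%type} :=
  HB.pack T0 (GRing.isLinear.Build _ _ _ _ _ T0lin).
pose g : {linear (K^o * A)%type -> K^o} := fst.
have gp u : `|g u| <= p (T u).
  case: u => t e; change (`|t| <= p (T0 (t, e))).
  have [->|t0] := eqVneq t 0; first by rewrite normr0.
  have -> : T0 (t, e) = t *: (y0 - S (t^-1 *: e), t^-1 *: e).
    rewrite /T0/=; congr pair => /=; last by rewrite scalerA divff// scale1r.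
    by rewrite [S (_ *: e)]linearZ scalerBr scalerA divff// scale1r.
  by rewrite sp.2 ler_peMr.
have [h [hlin hp hT]] := hahn_banach sp gp.
have [phi phiE] : exists phi : dual Y, forall y, phi y = h (y, 0).
  apply: (@bounded_linear_dual _ (fun y => h (y, 0)) eps^-1).
    move=> a u v; rewrite -hlin; congr h; congr pair => /=.
    by rewrite scaler0 addr0.
  by move=> y; rewrite (le_trans (hp _))// /p/= normr0 mul0r addr0 mulrC.
have hM e : `|h (0, e) : K| <= M^-1 * `|e|.
  by rewrite (le_trans (hp _))// /p/= normr0 mul0r add0r mulrC.
have [chi chiE] : exists chi : dual A, forall e, chi e = h (0, e).
  apply: (@bounded_linear_dual _ (fun e => h (0, e)) M^-1) => //.
  move=> a u v; rewrite -hlin; congr h; congr pair => /=.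
  by rewrite scaler0 addr0.
have echi : e'' chi = 1.
  rewrite (he phi).
    have := hT (1, 0); rewrite /T/= /T0/= /g/= scale1r linear0 subr0 => <-.
    exact: phiE.
  move=> e; rewrite chiE phiE.
  have -> : h (0, e) = h (S e, 0) + h (T (0, e)).
    have := hlin 1 (S e, 0) (T (0, e)); rewrite !scale1r => <-; congr h.
    by rewrite /T/= /T0/= scale0r sub0r; congr pair => /=; rewrite ?addrN ?add0r.
  by rewrite hT addr0.
have chiM : `|chi| <= M^-1.
  by apply: opnorm_le => [|e]; rewrite ?invr_ge0 ?(ltW M0)// chiE.
have := le_opnorm e'' chi; rewrite echi normr1 => one_le.
have : 1 < (1 : K); last by rewrite ltxx.
apply: (le_lt_trans one_le); apply: (@le_lt_trans _ _ (`|e''| * M^-1)).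
  by rewrite ler_wpM2l ?opnorm_ge0.
by rewrite ltr_pdivrMr// mul1r ltrDl.
Qed.

End functionals.

(** * Geometric convergence *)

Section geometric.
Context {R : realType} {k : scalar_kind}.
Local Notation K := (scalars R k).

(** Over the complex numbers the order is partial, but [r] and [eps] are
    comparable with 0, hence real. *)
Lemma geometric_small (r eps : K) :
  0 <= r < 1 -> 0 < eps -> exists n, r ^+ n < eps.
Proof.
have real_case (s e : R) : 0 <= s < 1 -> 0 < e -> exists n, s ^+ n < e.
  move=> /andP[s0 s1] e0; have /cvgrPdist_lt/(_ e e0)[n _ /(_ n)] :
      s ^+ n @[n --> \oo] --> (0 : R) by apply: cvg_expr; rewrite ger0_norm.
  by rewrite /= leqnn sub0r normrN ger0_norm ?exprn_ge0// => /(_ isT) ?; exists n.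
case: k r eps => [|] r eps; first exact: real_case.
move=> /andP[r0 r1] eps0.
rewrite -[r]RRe_real ?ger0_real// -[eps]RRe_real ?gtr0_real//.
have [||n nlt] := real_case (complex.Re r) (complex.Re eps).
- by rewrite -!(lecR, ltcR) RRe_real ?ger0_real// r0.
- by rewrite -ltcR RRe_real ?gtr0_real.
- by exists n; rewrite -rmorphXn ltcR.
Qed.

Lemma geometric_cvg (A : completeNormedModType K) (b : nat -> A) (C r : K) :
  0 <= C -> 0 <= r < 1 -> (forall n, `|b n.+1 - b n| <= C * r ^+ n) ->
  exists a : A, forall eps, 0 < eps ->
    exists N, forall n, (N <= n)%N -> `|b n - a| < eps.
Proof.
move=> C0 /andP[r0 r1] bC.
have r1' : 0 < 1 - r by rewrite subr_gt0.
pose D := C / (1 - r).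
have D0 : 0 <= D by rewrite divr_ge0// ltW.
(* The partial sums of the geometric series, kept exact for the induction. *)
have tele n m : `|b (n + m)%N - b n| <= D * (r ^+ n - r ^+ (n + m)).
  elim: m => [|m IH]; first by rewrite addn0 !subrr normr0 mulr0.
  rewrite addnS -(subrKA (b (n + m)%N)) (le_trans (ler_normD _ _))//.
  apply: (le_trans (lerD (bC _) IH)).
  rewrite -[C in leLHS](divfK (lt0r_neq0 r1')) -/D -mulrA -mulrDr.
  by rewrite mulrBl mul1r exprS [X in _ * X]addrC addrA subrK.
have tail n m : (n <= m)%N -> `|b m - b n| <= D * r ^+ n.
  move=> /subnKC <-; apply: (le_trans (tele _ _)).
  by rewrite ler_wpM2l// gerBl exprn_ge0.
have small eps : 0 < eps -> exists n, D * r ^+ n < eps.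
  move=> eps0; have D1 : 0 < D + 1 by rewrite ltr_wpDl.
  have [||n rn] := @geometric_small r (eps / (D + 1)).
  - by rewrite r0.
  - by rewrite divr_gt0.
  exists n; apply: (@le_lt_trans _ _ ((D + 1) * r ^+ n)).
    by rewrite ler_wpM2r ?exprn_ge0// lerDl.
  by rewrite mulrC -ltr_pdivlMr.
have cb : cauchy (b @ \oo).
  apply: cauchy_exP => eps eps0.
  have [n Dn] := small _ eps0; exists (b n); exists n => // m /= nm.
  by rewrite -ball_normE/= distrC (le_lt_trans (tail _ _ nm)).
have /cvg_ex[a ba] : cvg (b @ \oo) by apply/cauchy_cvgP.
exists a => eps eps0.
have [N _ NP] := (cvgrPdist_lt _ _).1 ba eps eps0.
by exists N => n Nn; rewrite distrC; exact: NP.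
Qed.

End geometric.

(** * Cohen factorization in a dual module *)

Section factorization.
Context {R : realType} {k : scalar_kind}.
Local Notation K := (scalars R k).

(** Write [a_n = r^n + b_n] for the product of the [n] first factors
    [(1-c) + c e_j], with [r = 1 - c] and [b_n] in A; [L n] and [U n] are the
    actions on B of [a_n] and of the next factor.  The next factor multiplies on the
    right: then [b_(n+1) - b_n] involves only [b_n - b_n e_n], which a right
    approximate unit makes small. *)
Theorem cohen_factorization (A B : completeNormedModType K)
    (pi : bounded_bilinear A A A) (pil : bounded_bilinear A B B)
    (M : K) (x : dual B) :
  left_banach_module pi pil -> 0 <= M ->
  (forall (a : A) (eps : K), 0 < eps ->
     exists e : A, [/\ `|e| <= M, `|a - pi a e| <= eps &
                       `|x - dual_ract pil x e| <= eps]) ->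
  exists (a : A) (y : dual B), dual_ract pil y a = x.
Proof.
move=> pilA M0 approx.
have [kp kp0 pil_le] := bb_bounded_ge0 pil.
have kM0 : 0 < 1 + kp * M by rewrite ltr_pwDl// mulr_ge0.
(* With this c, (1-c) - c kp M = 1/2, which bounds U n below by one half. *)
pose c : K := 2^-1 / (1 + kp * M).
have c0 : 0 < c by rewrite divr_gt0// invr_gt0.
have c_half : c * (1 + kp * M) = 2^-1 by rewrite divfK ?lt0r_neq0.
have c_le : c <= 2^-1.
  by rewrite -c_half ler_peMr ?(ltW c0)// lerDl mulr_ge0.
have c_le1 : c <= 1 by rewrite (le_trans c_le)// invf_le1 ?ler1n.
clearbody c.
have half2 : 2^-1 + 2^-1 = 1 :> K.
  by rewrite -[X in X + _]div1r -[X in _ + X]div1r -splitr.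
pose r : K := 1 - c.
have half_le : 2^-1 <= r by rewrite /r lerBrDr -[leRHS]half2 lerD2l.
have half_ge0 : 0 <= 2^-1 :> K by rewrite invr_ge0.
have r0 : 0 <= r by exact: le_trans half_le.
have r_lt1 : r < 1 by rewrite /r ltrBlDr ltrDl.
(* L n is bounded below only by 2^-n, so an error of order 4^-n in the choice
   of e_n costs 2^-n in the constant C below. *)
pose eps (n : nat) : K := 4^-1 ^+ n.
have eps0 n : 0 < eps n by rewrite exprn_gt0// invr_gt0.
have [u uP] := choice (fun na : nat * A => approx na.2 (eps na.1) (eps0 na.1)).
pose b := fix b n := if n is m.+1 then
  let e := u (m, b m) in r *: b m + (c * r ^+ m) *: e + c *: pi (b m) e else 0.
pose e n := u (n, b n).
have bS n : b n.+1 = r *: b n + (c * r ^+ n) *: e n + c *: pi (b n) (e n) by [].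
have eM n : `|e n| <= M by have [] := uP (n, b n).
have be n : `|b n - pi (b n) (e n)| <= eps n by have [] := uP (n, b n).
have xe n : `|x - dual_ract pil x (e n)| <= eps n by have [] := uP (n, b n).
clearbody e.
pose L n v := r ^+ n *: v + pil (b n) v.
pose U n v := r *: v + c *: pil (e n) v.
have L0 v : L 0%N v = v by rewrite /L expr0 scale1r linear0l addr0.
have LS n v : L n.+1 v = L n (U n v).
  rewrite /L /U bS !linearDl !linearZl_LR/= linearDr/= !linearZr_LR/=.
  rewrite pilA exprSr scalerDr !scalerA [r ^+ n * c]mulrC -!addrA.
  by congr (_ + _); rewrite addrCA.
have U_ge n v : `|v| <= 2 * `|U n v|.
  have rE : r = 2^-1 + c * (kp * M).
    by rewrite /r -[X in X - _]half2 -{2}c_half mulrDr mulr1 addrA addrAC addrK.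
  have : r * `|v| <= `|U n v| + c * (kp * M) * `|v|.
    have -> : r * `|v| = `|U n v - c *: pil (e n) v|.
      by rewrite /U addrK normrZ (ger0_norm r0).
    rewrite (le_trans (ler_normB _ _))// lerD2l normrZ gtr0_norm// -mulrA.
    rewrite ler_wpM2l ?(ltW c0)// (le_trans (pil_le _ _))// ler_wpM2r//.
    by rewrite ler_wpM2l.
  by rewrite rE mulrDl lerD2r -ler_pdivlMl ?invr_gt0// invrK.
have L_ge n v : `|v| <= 2 ^+ n * `|L n v|.
  elim: n v => [|n IH] v; first by rewrite L0 expr0 mul1r.
  rewrite LS exprS -mulrA; apply: (le_trans (U_ge n v)).
  by rewrite ler_wpM2l.
(* The constants increase by 2^-n, and stay below |x| + 2. *)
pose C (n : nat) : K := `|x| + 2 - 2 * 2^-1 ^+ n.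
have xL n v : `|x v| <= C n * `|L n v|.
  elim: n v => [|n IH] v.
    by rewrite L0 /C expr0 mulr1 addrK le_opnorm.
  have -> : x v = x (U n v) + c * (x - dual_ract pil x (e n)) v.
    have -> : (x - dual_ract pil x (e n)) v = x v - x (pil (e n) v) by [].
    have -> : x (U n v) = r * x v + c * x (pil (e n) v).
      by rewrite /U linearD !linearZ.
    rewrite mulrBl mul1r mulrBr -addrA.
    by rewrite [c * x (pil _ _) + _]addrC !subrK.
  rewrite (le_trans (ler_normD _ _))//.
  have -> : C n.+1 = C n + 2^-1 ^+ n.
    have half2n : 2 * 2^-1 ^+ n.+1 = 2^-1 ^+ n :> K.
      by rewrite exprS mulrA divff ?pnatr_eq0// mul1r.
    rewrite /C half2n mulr_natl [_ ^+ n *+ 2]mulr2n opprD.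
    by rewrite [X in _ = X + _]addrA subrK.
  rewrite mulrDl lerD//; first by rewrite LS.
  rewrite normrM (gtr0_norm c0).
  apply: (@le_trans _ _ (2^-1 * (eps n * (2 ^+ n.+1 * `|L n.+1 v|)))).
    rewrite ler_pM ?(ltW c0)// (le_trans (le_opnorm _ _))//.
    by rewrite ler_pM ?opnorm_ge0//; exact: xe.
  rewrite !mulrA ler_wpM2r// exprS /eps.
  have -> : 4^-1 = 2^-1 * 2^-1 :> K by rewrite -invfM -natrM.
  rewrite exprMn mulrCA -!mulrA mulrA divff ?pnatr_eq0// mul1r.
  by rewrite -exprMn mulVf ?pnatr_eq0// expr1n mulr1.
have [a ba] : exists a : A, forall eps, 0 < eps ->
    exists N, forall n, (N <= n)%N -> `|b n - a| < eps.
  apply: (@geometric_cvg _ _ _ _ (M + 1) r) => [||n].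
  - by rewrite addr_ge0.
  - by rewrite r0.
  have -> : b n.+1 - b n = (c * r ^+ n) *: e n - c *: (b n - pi (b n) (e n)).
    rewrite bS /r scalerBl scale1r scalerBr opprB.
    by rewrite -!addrA addrC -!addrA addNr addr0 addrC -addrA.
  rewrite (le_trans (ler_normB _ _))// mulrDl mul1r lerD// normrZ.
    rewrite ger0_norm ?mulr_ge0 ?exprn_ge0 ?(ltW c0)// mulrC ler_pM//.
      by rewrite mulr_ge0 ?exprn_ge0 ?(ltW c0).
    by rewrite ler_piMl ?exprn_ge0.
  rewrite (gtr0_norm c0) -[leRHS]mul1r ler_pM ?(ltW c0)//.
  apply: (le_trans (be n)); rewrite lerXn2r ?nnegrE ?invr_ge0//.
  by rewrite (le_trans _ half_le)// lef_pV2 ?posrE// ler_nat.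
(* Let n tend to infinity in xL. *)
have xa v : `|x v| <= (`|x| + 2) * `|pil a v|.
  apply/ler_addgt0Pr => d d0.
  pose W : K := (`|x| + 2) * (`|v| + kp * `|v|) + 1.
  have Q0 : 0 <= `|x| + 2 :> K by rewrite addr_ge0.
  have W0 : 0 < W by rewrite ltr_wpDl// mulr_ge0// addr_ge0// mulr_ge0.
  have [||m rm] := @geometric_small _ _ r (d / W); rewrite ?r0 ?divr_gt0//.
  have [N baN] := ba _ (divr_gt0 d0 W0).
  pose n := (N + m)%N.
  have rn : r ^+ n <= d / W.
    rewrite exprD (le_trans _ (ltW rm))// ler_piMl ?exprn_ge0//.
    by rewrite exprn_ile1// ltW.
  have bn : `|b n - a| <= d / W by rewrite ltW// baN// leq_addr.
  apply: (le_trans (xL n v)).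
  apply: (@le_trans _ _ ((`|x| + 2) * `|L n v|)).
    by rewrite ler_wpM2r// /C gerBl mulr_ge0// exprn_ge0.
  have -> : L n v = r ^+ n *: v + pil (b n - a) v + pil a v.
    by rewrite /L linearBl addrA subrK.
  rewrite [leRHS]addrC (le_trans (ler_wpM2l Q0 (ler_normD _ _)))//.
  rewrite mulrDr lerD2r.
  apply: (@le_trans _ _ ((`|x| + 2) * (d / W * (`|v| + kp * `|v|)))).
    rewrite ler_wpM2l// (le_trans (ler_normD _ _))// mulrDr lerD//.
      by rewrite normrZ ger0_norm ?exprn_ge0// ler_wpM2r.
    rewrite (le_trans (pil_le _ _))// [leRHS]mulrA ler_wpM2r//.
    by rewrite mulrC ler_wpM2r.
  rewrite mulrCA -[leRHS](divfK (lt0r_neq0 W0)) ler_wpM2l//.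
    by rewrite divr_ge0// ltW.
  by rewrite /W lerDl.
have x2 : 0 <= `|x| + 2 :> K by rewrite addr_ge0.
have [y yE] := @dual_factor _ _ _ _ (pil a) x _ x2 xa.
by exists a, y; apply: dualP => v; exact: yE.
Qed.

End factorization.

(** * Factorization and units of the second dual *)

Section left_module.
Context {R : realType} {k : scalar_kind}.
Local Notation K := (scalars R k).

Context {A B : completeNormedModType K} (pi : bounded_bilinear A A A).
Context (e'' : bidual A) (pi_e'' : forall a'', triadjoint pi a'' e'' = a'').

Lemma right_unit_adjoint (f : dual A) (a : A) : e'' (adjoint pi f a) = f a.
Proof.
have [a'' a''E] : exists a'' : bidual A, forall g : dual A, a'' g = g a.
  apply: (@bounded_linear_dual _ _ _ (fun g : dual A => g a) `|a|) => // g.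
  by rewrite mulrC; exact: le_opnorm.
rewrite -[RHS]a''E -[in RHS](pi_e'' a'').
exact: esym (a''E (adjoint (adjoint pi) e'' f)).
Qed.

Context (pil : bounded_bilinear A B B) (pilA : left_banach_module pi pil).

Lemma factors_left_unit : factors_left pil -> left_unit_module pil e''.
Proof.
move=> fl b''; apply: dualP => b'.
have : [set: dual B] b' by [].
rewrite fl => -[c' _ [a _ <-]] /=.
rewrite -[RHS](right_unit_adjoint (adjoint (adjoint pil) b'' c') a).
congr (e'' _); apply: dualP => x /=; congr (b'' _); apply: dualP => b /=.
by rewrite pilA.
Qed.

(** Both conditions are one approximation in the product of A and the dual
    of B, whose functionals are pairs; on each component [e''] behaves as a
    unit. *)
Lemma unit_approximation : left_unit_module pil e'' ->
  forall (b' : dual B) (a : A) (eps : K), 0 < eps ->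
  exists e : A, [/\ `|e| <= `|e''| + 1, `|a - pi a e| <= eps &
                    `|b' - dual_ract pil b' e| <= eps].
Proof.
move=> ue b' a eps eps0.
pose S0 (e : A) : A * dual B := (pi a e, dual_ract pil b' e).
have S0lin : linear S0.
  by move=> s u v; rewrite /S0 !linearPr.
pose S : {linear A -> (A * dual B)%type} :=
  HB.pack S0 (GRing.isLinear.Build _ _ _ _ _ S0lin).
have [phi chi phichi|e [eM eS]] :=
    @bidual_approximation R k _ _ S (a, b') e'' _ eps eps0; last first.
  move: eS; rewrite prod_normE/= comparable_ge_max ?real_comparable ?normr_real//.
  move=> /andP[? ?].
  by exists e.
have [phi1 phi1E] : exists phi1 : dual A, forall x, phi1 x = phi (x, 0).
  apply: (@bounded_linear_dual _ _ _ (fun x => phi (x, 0)) `|phi|).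
    move=> s u v; rewrite -linearP; congr (phi (_, _)) => /=.
    by rewrite scaler0 addr0.
  move=> x; rewrite (le_trans (le_opnorm _ _))// ler_wpM2l ?opnorm_ge0//.
  rewrite prod_normE/= normr0 comparable_ge_max ?real_comparable ?normr_real//.
  by rewrite lexx normr_ge0.
have [phi2 phi2E] : exists phi2 : bidual B, forall x, phi2 x = phi (0, x).
  apply: (@bounded_linear_dual _ _ _ (fun x => phi (0, x)) `|phi|).
    move=> s u v; rewrite -linearP; congr (phi (_, _)) => /=.
    by rewrite scaler0 addr0.
  move=> x; rewrite (le_trans (le_opnorm _ _))// ler_wpM2l ?opnorm_ge0//.
  rewrite prod_normE/= normr0 comparable_ge_max ?real_comparable ?normr_real//.
  by rewrite lexx normr_ge0.
have phiE x y : phi (x, y) = phi1 x + phi2 y.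
  by rewrite phi1E phi2E -linearD; congr (phi (_, _)) => /=; rewrite ?addr0 ?add0r.
have -> : chi = adjoint pi phi1 a + adjoint (adjoint pil) phi2 b'.
  by apply: dualP => x; rewrite phichi phiE.
rewrite phiE -[in RHS](right_unit_adjoint phi1 a) -[in RHS](ue phi2).
exact: linearD.
Qed.

Lemma left_factorization_iff : factors_left pil <-> left_unit_module pil e''.
Proof.
split; first exact: factors_left_unit.
move=> ue; apply/seteqP; split=> // b' _.
have M0 : 0 <= `|e''| + 1 by rewrite addr_ge0.
have [a [y <-]] := cohen_factorization pilA M0 (unit_approximation ue b').
by exists y => //; exists a.
Qed.

End left_module.

Theorem mainTheorem5 (R : realType) (k : scalar_kind)
    (A : completeNormedModType (scalars R k)) (pi : bounded_bilinear A A A)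
    (hA : banach_algebra pi) (e'' : bidual A) (he : mixed_unit pi e'') :
  (forall (B : completeNormedModType (scalars R k))
      (pil : bounded_bilinear A B B),
    left_banach_module pi pil ->
    (factors_left pil <-> left_unit_module pil e''))
  /\
  (forall (B : completeNormedModType (scalars R k))
      (pir : bounded_bilinear B A B),
    right_banach_module pi pir ->
    locally_top_center pir e'' = [set: bidual B] ->
    (factors_right pir <-> right_unit_module pir e''))
  /\
  (forall (B : completeNormedModType (scalars R k))
      (pil : bounded_bilinear A B B) (pir : bounded_bilinear B A B),
    banach_bimodule pi pil pir ->
    locally_top_center pir e'' = [set: bidual B] ->
    ((factors_left pil /\ factors_right pir) <->
     (left_unit_module pil e'' /\ right_unit_module pir e''))).
Proof.
have left_iff (B : completeNormedModType (scalars R k))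
    (pil : bounded_bilinear A B B) : left_banach_module pi pil ->
    (factors_left pil <-> left_unit_module pil e'').
  by apply: left_factorization_iff => a''; exact: (he a'').1.
have right_iff (B : completeNormedModType (scalars R k))
    (pir : bounded_bilinear B A B) : right_banach_module pi pir ->
    locally_top_center pir e'' = [set: bidual B] ->
    (factors_right pir <-> right_unit_module pir e'').
  move=> pirA Z.
  have opA : left_banach_module (transpose pi) (transpose pir).
    by move=> a a' b; exact: pirA.
  have -> : factors_right pir <-> factors_left (transpose pir).
    rewrite /factors_right /factors_left.
    suff -> : [set dual_lact pir a b' | a in setT & b' in setT] =
        [set dual_ract (transpose pir) b' a | b' in setT & a in setT] by [].
    by apply/seteqP; split=> _ [x _ [y _ <-]]; exists y => //; exists x.
  have -> : right_unit_module pir e'' <-> left_unit_module (transpose pir) e''.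
    have ZE b'' : triadjoint (transpose pir) e'' b'' = triadjoint pir b'' e''.
      by have : [set: bidual B] b'' by []; rewrite -Z.
    by split=> u b''; have := u b''; rewrite ?ZE// -ZE.
  by apply: left_factorization_iff => // a''; exact: (he a'').2.
split=> [//|]; split=> // B pil pir [pilA pirA _] Z.
by split=> -[? ?]; split; apply/left_iff || apply/right_iff.
Qed.
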